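(* Let $L$ be a locally compact Hausdorff topological space and consider the real Banach space $C_0(L)$. Let $0<\varepsilon<1/4$. If $f_0\in S_{C_0(L)}$, $\mu\in S_{C_0(L)^*}$ and $T\in\mathcal{L}(C_0(L))$ with $\|T\|=1$ satisfy $$\mu(f_0)>1-\frac{\varepsilon^2}{50}\quad\text{and}\quad |\mu(Tf_0)|=1,$$ then there exist $f_1\in S_{C_0(L)}$ and $\nu\in S_{C_0(L)^*}$ such that $$|\nu(Tf_1)|=\nu(f_1)=1,\quad \|f_1-f_0\|<\varepsilon,\quad \|\nu-\mu\|<\varepsilon.$$ In particular, every real $C_0(L)$ has property (nu).
   Context: $C_0(L)$ is the real Banach space of real-valued continuous functions on $L$ vanishing at infinity with the supremum norm; $S_X$ is the unit sphere of a Banach space $X$, $X^*$ its topological dual, $\mathcal{L}(X)$ the bounded linear operators on $X$. Property (nu): a Banach space $X$ has property (nu) if for every $\varepsilon>0$ there exists $\eta(\varepsilon)>0$ such that whenever $T\in S_{\mathcal{L}(X)}$, $x_0\in S_X$ and $x_0^*\in S_{X^*}$ satisfy $\operatorname{Re}x_0^*(x_0)>1-\eta(\varepsilon)$ and $|x_0^*(Tx_0)|=1$, there exist $x_1^*\in S_{X^*}$, $x_1\in S_X$ and $S\in S_{\mathcal{L}(X)}$ such that $|x_1^*(Sx_1)|=x_1^*(x_1)=1$ and $\max\{\|x_1-x_0\|,\|x_1^*-x_0^*\|,\|S-T\|\}<\varepsilon$. *)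

(* Defs.v *)
From HB Require Import structures.
From mathcomp Require Import all_boot all_order all_algebra.
From mathcomp Require Import all_classical all_reals all_analysis.
From mathcomp Require Import lra.

Set Implicit Arguments.
Unset Strict Implicit.
Unset Printing Implicit Defensive.

Import Order.TTheory GRing.Theory Num.Theory.
Import numFieldNormedType.Exports.

Local Open Scope classical_set_scope.
Local Open Scope ring_scope.

Section C0_pred.
Variables (R : realType) (L : topologicalType).
Implicit Types f g : L -> R.

Definition vanishes_at_infinity f :=
  forall e : R, 0 < e -> compact [set x | e <= `|f x|].

Definition C0_pred : {pred L -> R} :=
  mem [set f : L -> R | continuous f /\ vanishes_at_infinity f].

Lemma closed_norm_ge f (e : R) : continuous f -> closed [set x | e <= `|f x|].
Proof.
move=> cf.
apply: (@closed_comp _ _ (fun x => `|f x|) [set r : R | e <= r]);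
  last exact: closed_ge.
by move=> x _; apply: continuous_comp; [exact: cf|exact: norm_continuous].
Qed.

Lemma C0_pred_submod_closed : submod_closed C0_pred.
Proof.
split=> [|a f g].
  rewrite inE; split; first by move=> x; exact: cvg_cst.
  move=> e e0; rewrite (_ : [set _ | _] = set0); first exact: compact0.
  by rewrite -subset0 => x /=; rewrite normr0 leNgt e0.
rewrite !inE => -[cf vf] [cg vg].
have ch : continuous (a *: f + g).
  move=> x; apply: (@continuousD _ _ _ (a *: f) g); last exact: cg.
  by apply: (@continuousZr _ _ _ f a); exact: cf.
split => // e e0.
have a1 : 0 < `|a| + 1 by rewrite ltr_wpDl.
pose d := e / 2 / (`|a| + 1).
have d0 : 0 < d by rewrite !divr_gt0.
apply: (@subclosed_compact _ _
  ([set x | d <= `|f x|] `|` [set x | e / 2 <= `|g x|])).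
- exact: closed_norm_ge.
- by apply: compactU; [exact: vf|apply: vg; rewrite divr_gt0].
- move=> x /= ex; apply: contrapT => /not_orP[/negP + /negP].
  rewrite -!ltNge => fd gd.
  suff : `|a * f x + g x| < e by rewrite ltNge => /negP; exact.
  rewrite (le_lt_trans (ler_normD _ _))// (splitr e) ltr_leD ?(ltW gd)//.
  rewrite normrM; have [->|a0] := eqVneq a 0.
    by rewrite normr0 mul0r divr_gt0.
  rewrite (@lt_le_trans _ _ (`|a| * d))// ?ltr_pM2l ?normr_gt0//.
  rewrite /d mulrCA ler_piMr//; first by rewrite divr_ge0// ltW.
  by rewrite ler_pdivrMr// mul1r lerDl.
Qed.

HB.instance Definition _ :=
  GRing.isSubmodClosed.Build R (L -> R) C0_pred C0_pred_submod_closed.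

End C0_pred.

Section C0.
Variables (R : realType) (L : topologicalType).

Record C0 := MkC0 { C0_fun :> L -> R ; _ : C0_fun \in @C0_pred R L }.

HB.instance Definition _ := [isSub for C0_fun].
HB.instance Definition _ := [Choice of C0 by <:].
HB.instance Definition _ := [SubChoice_isSubLmodule of C0 by <:].
Implicit Types f g : C0.

Lemma C0_continuous f : continuous f.
Proof. by have := valP f; rewrite inE => -[]. Qed.

Lemma C0_vanishes_at_infinity f : vanishes_at_infinity f.
Proof. by have := valP f; rewrite inE => -[]. Qed.

(* If L is empty, this is sup set0 = 0, the norm of the trivial space. *)
Definition sup_norm f : R := sup [set `|f x| | x in [set: L]].

Lemma C0_has_ubound f : has_ubound [set `|f x| | x in [set: L]].
Proof.
have K := @C0_vanishes_at_infinity f 1 ltr01.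
have cnf : {within [set x | 1 <= `|f x|], continuous (fun x => `|f x|)}.
  apply: continuous_subspaceT => x.
  by apply: continuous_comp; [exact: C0_continuous|exact: norm_continuous].
have /compact_bounded[M [_ bM]] := continuous_compact cnf K.
exists (Num.max 1 (M + 1)) => _ [x _ <-]; rewrite le_max.
have [//|fx1] := leP `|f x| 1; apply/orP; right.
rewrite -[leLHS]normr_id; apply: (bM (M + 1)); first by rewrite ltrDl.
by exists x => //=; exact: ltW.
Qed.

Lemma le_sup_norm f x : `|f x| <= sup_norm f.
Proof. by apply: ub_le_sup; [exact: C0_has_ubound|exists x]. Qed.

Lemma sup_norm_le f (M : R) : 0 <= M ->
  (forall x, `|f x| <= M) -> sup_norm f <= M.
Proof.
move=> M0 fM; rewrite /sup_norm; set A := (X in sup X).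
have [->|/set0P ne] := eqVneq A set0.
  by rewrite sup0.
by apply: ge_sup => // _ [x _ <-].
Qed.

Lemma sup_norm_ge0 f : 0 <= sup_norm f.
Proof.
rewrite /sup_norm; set A := (X in sup X).
have [->|/set0P [_ [x _ _]]] := eqVneq A set0.
  by rewrite sup0.
exact: le_trans (le_sup_norm f x).
Qed.

Lemma sup_normD f g : sup_norm (f + g) <= sup_norm f + sup_norm g.
Proof.
apply: sup_norm_le => [|x]; first by rewrite addr_ge0 ?sup_norm_ge0.
by rewrite (le_trans (ler_normD _ _))// lerD ?le_sup_norm.
Qed.

Lemma sup_normZ (a : R) f : sup_norm (a *: f) = `|a| * sup_norm f.
Proof.
have leZ b h : sup_norm (b *: h) <= `|b| * sup_norm h.
  apply: sup_norm_le => [|x]; first by rewrite mulr_ge0 ?sup_norm_ge0.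
  by rewrite normrM ler_wpM2l// le_sup_norm.
apply/eqP; rewrite eq_le leZ/=.
have [->|a0] := eqVneq a 0; first by rewrite normr0 mul0r sup_norm_ge0.
rewrite -ler_pdivlMl ?normr_gt0// -normfV.
by have := leZ a^-1 (a *: f); rewrite scalerK.
Qed.

Lemma sup_norm0_eq0 f : sup_norm f = 0 -> f = 0.
Proof.
move=> f0; apply/val_inj/funext => x; apply/eqP.
by rewrite -normr_eq0 eq_le normr_ge0 andbT -f0 le_sup_norm.
Qed.

HB.instance Definition _ := Lmodule_isNormed.Build R C0
  sup_normD sup_normZ sup_norm0_eq0.

Lemma C0_normE f : `|f| = sup [set `|f x| | x in [set: L]].
Proof. by []. Qed.

Lemma ler_C0_norm f x : `|f x| <= `|f|.
Proof. exact: le_sup_norm. Qed.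

Lemma C0_complete (F : set_system C0) : ProperFilter F -> cauchy F -> cvg F.
Proof.
move=> FF Fc.
have Fb (e : R) : 0 < e -> exists f : C0, F (ball f e).
  by move=> e0; have /cauchyP := Fc; exact.
pose ev x : set_system R := (fun f : C0 => f x) @ F.
have evc x : cvg (ev x).
  apply: cauchy_cvg; apply: cauchy_exP => e e0.
  have [f Ff] := Fb _ e0; exists (f x).
  have : F [set h : C0 | ball (f x) e (h x)].
    apply: filterS Ff => h; rewrite -!ball_normE/= => fh.
    exact: le_lt_trans (ler_C0_norm (f - h) x) fh.
  by [].
pose g x : R := lim (ev x).
have Fg (e : R) : 0 < e -> F [set f : C0 | forall x, `|g x - f x| <= e].
  move=> e0; have [h Fh] := Fb _ (divr_gt0 e0 (ltr0n _ 2)).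
  have hg x : `|h x - g x| <= e / 2.
    have gx : (fun f : C0 => `|h x - f x|) @ F --> `|h x - g x|.
      by apply: cvg_norm; apply: cvgB; [exact: cvg_cst|exact: evc].
    apply: (cvgr_to_le gx).
    apply: filterS Fh => f; rewrite -ball_normE/= => /ltW.
    exact: le_trans (ler_C0_norm (h - f) x).
  apply: filterS Fh => f; rewrite -ball_normE/= => /ltW hf x.
  rewrite -(subrK (h x) (g x)) -addrA (le_trans (ler_normD _ _))//.
  rewrite (splitr e) lerD//; first by rewrite distrC.
  exact: le_trans (ler_C0_norm (h - f) x) hf.
have cg : continuous g.
  move=> x; apply/cvgrPdist_le => e e0.
  have e3 : 0 < e / 3 by rewrite divr_gt0.
  have [f fg] := filter_ex (Fg _ e3).
  have /cvgrPdist_le/(_ _ e3) := @C0_continuous f x.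
  apply: filterS => y fxy.
  rewrite (_ : g x - g y = (g x - f x) + (f x - f y) + (f y - g y)); last first.
    by rewrite !addrA !subrK.
  rewrite (le_trans (ler_normD _ _))//.
  rewrite (_ : e = e / 3 + e / 3 + e / 3); last by lra.
  rewrite lerD//; last by rewrite distrC.
  by rewrite (le_trans (ler_normD _ _))// lerD.
have g0 : g \in @C0_pred R L.
  rewrite inE; split => // e e0.
  have e2 : 0 < e / 2 by rewrite divr_gt0.
  have [f fg] := filter_ex (Fg _ e2).
  apply: (subclosed_compact (closed_norm_ge cg)
    (@C0_vanishes_at_infinity f _ e2)) => x /= egx.
  rewrite -(lerD2l (e / 2)) -splitr (le_trans egx)//.
  rewrite -{1}(subrK (f x) (g x)) (le_trans (ler_normD _ _))// lerD//.
apply/cvg_ex; exists (MkC0 g0); apply/cvgrPdist_le => e e0.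
apply: filterS (Fg _ e0) => f fg.
by apply: sup_norm_le => // ; exact: ltW.
Qed.

HB.instance Definition _ := Uniform_isComplete.Build C0 C0_complete.

End C0.

(* The library's bounded_fun_norm: bounded on every ball. *)
Section bounded_op_pred.
Variables (R : realType) (V W : normedModType R).

Definition bounded_op_pred : {pred V -> W} :=
  mem [set T : V -> W | linear T /\ bounded_fun_norm T].

Lemma bounded_op_pred_submod_closed : submod_closed bounded_op_pred.
Proof.
split=> [|a S T].
  rewrite inE; split.
    by move=> k x y /=; rewrite scaler0 addr0.
  by move=> r; exists 0 => x _; rewrite normr0.
rewrite !inE => -[lS bS] [lT bT]; split.
  move=> k x y; rewrite /= !fctE lS lT !scalerDr !scalerA (mulrC a k).
  by rewrite addrACA.
move=> r; have [M SM] := bS r; have [N TN] := bT r.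
exists (`|a| * M + N) => x xr.
rewrite (le_trans (ler_normD _ _))// lerD ?TN//.
by rewrite normrZ ler_wpM2l// SM.
Qed.

HB.instance Definition _ := GRing.isSubmodClosed.Build R (V -> W)
  bounded_op_pred bounded_op_pred_submod_closed.

End bounded_op_pred.

Section bounded_op.
Variables (R : realType) (V W : normedModType R).

Record bounded_op := MkBoundedOp
  { bounded_op_fun :> V -> W ; _ : bounded_op_fun \in @bounded_op_pred R V W }.

HB.instance Definition _ := [isSub for bounded_op_fun].
HB.instance Definition _ := [Choice of bounded_op by <:].
HB.instance Definition _ := [SubChoice_isSubLmodule of bounded_op by <:].
Implicit Types S T : bounded_op.

Lemma bounded_op_linear T : linear T.
Proof. by have := valP T; rewrite inE => -[]. Qed.

Lemma bounded_op_bounded T : bounded_fun_norm T.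
Proof. by have := valP T; rewrite inE => -[]. Qed.

HB.instance Definition _ T :=
  GRing.isLinear.Build R V W *:%R (bounded_op_fun T) (bounded_op_linear T).

Definition op_norm T : R := sup [set `|T x| | x in [set x : V | `|x| <= 1]].

Lemma bounded_op_has_sup T :
  has_sup [set `|T x| | x in [set x : V | `|x| <= 1]].
Proof.
split; first by exists `|T 0|, 0 => //=; rewrite normr0.
have [M TM] := @bounded_op_bounded T 1.
by exists M => _ [x x1 <-]; exact: TM.
Qed.

Lemma op_norm_ge0 T : 0 <= op_norm T.
Proof.
apply: (@le_trans _ _ `|T 0|) => //.
apply: ub_le_sup; first by case: (bounded_op_has_sup T).
by exists 0 => //=; rewrite normr0.
Qed.

Lemma le_op_norm T x : `|T x| <= op_norm T * `|x|.
Proof.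
have [->|x0] := eqVneq x 0; first by rewrite linear0 !normr0 mulr0.
rewrite -ler_pdivrMr ?normr_gt0// mulrC -[X in X * _]gtr0_norm; last first.
  by rewrite invr_gt0 normr_gt0.
rewrite -normrZ -linearZ; apply: ub_le_sup.
  by case: (bounded_op_has_sup T).
by exists (`|x|^-1 *: x) => //=; rewrite normfZV.
Qed.

Lemma op_norm_le T (M : R) :
  (forall x, `|x| <= 1 -> `|T x| <= M) -> op_norm T <= M.
Proof.
move=> TM; apply: ge_sup; first by case: (bounded_op_has_sup T).
by move=> _ [x x1 <-]; exact: TM.
Qed.

Lemma op_norm_le1 T x : `|x| <= 1 -> `|T x| <= op_norm T.
Proof.
by move=> x1; rewrite (le_trans (le_op_norm T x))// ler_piMr// op_norm_ge0.
Qed.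

Lemma op_normD S T : op_norm (S + T) <= op_norm S + op_norm T.
Proof.
apply: op_norm_le => x x1.
by rewrite (le_trans (ler_normD _ _))// lerD ?op_norm_le1.
Qed.

Lemma op_normZ (a : R) T : op_norm (a *: T) = `|a| * op_norm T.
Proof.
have leZ b U : op_norm (b *: U) <= `|b| * op_norm U.
  by apply: op_norm_le => x x1; rewrite normrZ ler_wpM2l// op_norm_le1.
apply/eqP; rewrite eq_le leZ/=.
have [->|a0] := eqVneq a 0; first by rewrite normr0 mul0r op_norm_ge0.
rewrite -ler_pdivlMl ?normr_gt0// -normfV.
by have := leZ a^-1 (a *: T); rewrite scalerK.
Qed.

Lemma op_norm0_eq0 T : op_norm T = 0 -> T = 0.
Proof.
move=> T0; apply/val_inj/funext => x; apply/eqP.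
rewrite -normr_eq0 eq_le normr_ge0 andbT.
by rewrite (le_trans (le_op_norm T x))// T0 mul0r.
Qed.

HB.instance Definition _ := Lmodule_isNormed.Build R bounded_op
  op_normD op_normZ op_norm0_eq0.

Lemma bounded_op_normE T :
  `|T| = sup [set `|T x| | x in [set x : V | `|x| <= 1]].
Proof. by []. Qed.

End bounded_op.

Definition dual (R : realType) (V : normedModType R) := bounded_op V R^o.

(* The scalars are real: the real part in the usual definition is the identity. *)
Definition property_nu (R : realType) (X : completeNormedModType R) :=
  forall e : R, 0 < e -> exists2 eta : R, 0 < eta &
    forall (T : bounded_op X X) (x0 : X) (phi0 : dual X),
      `|T| = 1 -> `|x0| = 1 -> `|phi0| = 1 ->
      1 - eta < phi0 x0 -> `|phi0 (T x0)| = 1 ->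
      exists (phi1 : dual X) (x1 : X) (S : bounded_op X X),
        [/\ [/\ `|phi1| = 1, `|x1| = 1 & `|S| = 1],
            `|phi1 (S x1)| = 1, phi1 x1 = 1 &
            Num.max (Num.max `|x1 - x0| `|phi1 - phi0|) `|S - T| < e].

(* Main.v *)
(* With a = e / 2, truncate f0 / (1 - a) at +-1 to get f1: then
   f0 = (1 - a) f1 + a k with |k| <= 1, so |mu (T f0)| = 1 forces
   |mu (T f1)| = 1.  Hence mu attains its norm at g = mu (T f1) T f1.  Instead
   of restricting the measure mu to the set where f0 g is close to 1, multiply
   it by a continuous function w of f0 g, supported in {f0 g >= 1 - a}, and
   normalize: nu u = mu (w u) / mu (w g).  The support of w lies where f1 is the
   sign of g, so nu f1 = nu g = 1.  No representation of the dual is needed: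
   every estimate on mu has the form "mu v <= 0 because |g + v| <= 1". *)
Require Import Defs.
From mathcomp Require Import all_boot all_order all_algebra.
From mathcomp Require Import all_classical all_reals all_analysis.
From mathcomp Require Import lra ring.
Import Order.TTheory GRing.Theory Num.Theory.
Import numFieldNormedType.Exports.
Local Open Scope classical_set_scope.
Local Open Scope ring_scope.

(** * Pointwise inequalities for the truncation and the cutoff *)

Section clip_ramp.
Context {R : realType}.
Implicit Types a f g s u w : R.

Definition clip a s : R := Num.max (-1) (Num.min 1 ((1 - a)^-1 * s)).

(** The continuous weight [w]. No cap from above: it is evaluated only at products [f * g], which
    are at most 1. *)
Definition ramp a s : R := Num.max 0 (1 - a^-1 * (1 - s)).

Lemma continuous_clip a : continuous (clip a).
Proof.
move=> s; apply: (@continuous_max R R (fun=> -1)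
  (fun t => Num.min 1 ((1 - a)^-1 * t))); first exact: cvg_cst.
apply: (@continuous_min R R (fun=> 1) (fun t => (1 - a)^-1 * t)).
  exact: cvg_cst.
exact: mulrl_continuous.
Qed.

Lemma continuous_ramp a : continuous (ramp a).
Proof.
move=> s; apply: (@continuous_max R R (fun=> 0)
  (fun t => 1 - a^-1 * (1 - t))); first exact: cvg_cst.
apply: cvgB; first exact: cvg_cst.
apply: cvgM; first exact: cvg_cst.
by apply: cvgB; [exact: cvg_cst|exact: cvg_id].
Qed.

(** Free of [max], [min] and inverses, so that linear and nonlinear arithmetic can finish after a
    case split. *)
Lemma clip_cases a s : 0 < a < 1 ->
  [\/ 1 - a <= s /\ clip a s = 1, s <= - (1 - a) /\ clip a s = -1 |
      `|s| <= 1 - a /\ (1 - a) * clip a s = s].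
Proof.
move=> /andP[a0 a1]; have b0 : 0 < 1 - a by lra.
have E : (1 - a) * ((1 - a)^-1 * s) = s by rewrite mulVKf ?gt_eqF.
have [sb|bs] := leP (1 - a) s.
  apply: Or31; split=> //; rewrite /clip min_l; first by rewrite max_r//; lra.
  by rewrite -(ler_pM2l b0) E mulr1.
have [sb|sb] := leP s (- (1 - a)).
  apply: Or32; split=> //; rewrite /clip.
  have S : (1 - a)^-1 * s <= -1 by rewrite -(ler_pM2l b0) E mulrN1.
  by rewrite min_r ?max_l//; lra.
apply: Or33; split; first by rewrite ler_norml; lra.
rewrite /clip min_r ?max_r//.
- by rewrite -(ler_pM2l b0) E mulrN1 ltW.
- by rewrite -(ler_pM2l b0) E mulr1 ltW.
Qed.

Lemma normr_clip_le1 a s : `|clip a s| <= 1.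
Proof.
by rewrite ler_norml /clip le_max lexx/= ge_max ge_min lexx/= andbT; lra.
Qed.

(** A linear bound at 0 makes the truncation of a function vanishing at infinity vanish there too;
    [normr_ramp_le] does the same for the weight. *)
Lemma normr_clip_le a s : 0 < a < 1 -> `|clip a s| <= (1 - a)^-1 * `|s|.
Proof.
move=> a01; have b0 : 0 < 1 - a by lra.
rewrite -(ler_pM2l b0) mulVKf ?gt_eqF//.
case: (clip_cases _ s a01) => -[sb E].
- by rewrite E normr1 mulr1 (le_trans sb)// ler_norm.
- by rewrite E normrN1 mulr1 -normrN (le_trans _ (ler_norm _))//; lra.
- by rewrite -[in leRHS]E normrM (ger0_norm (ltW b0)).
Qed.

Lemma clip_dist_le a s : 0 < a < 1 -> `|s| <= 1 -> `|clip a s - s| <= a.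
Proof.
move=> a01; rewrite !ler_norml => /andP[s1 s2].
have := normr_clip_le1 a s; rewrite ler_norml => /andP[c1 c2].
by case: (clip_cases _ s a01) => -[]; rewrite ?ler_norml => sb E; nra.
Qed.

Lemma clip_rest_le a s : 0 < a < 1 -> `|s| <= 1 ->
  `|s - (1 - a) * clip a s| <= a.
Proof.
move=> a01; rewrite !ler_norml => /andP[s1 s2].
by case: (clip_cases _ s a01) => -[]; rewrite ?ler_norml => sb E; rewrite E; lra.
Qed.

Lemma ramp_cases a s : 0 < a ->
  (s <= 1 - a /\ ramp a s = 0) \/ (1 - a <= s /\ a * (1 - ramp a s) = 1 - s).
Proof.
move=> a0.
have E : a * (a^-1 * (1 - s)) = 1 - s by rewrite mulVKf ?gt_eqF.
have [sa|sa] := leP s (1 - a).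
  left; split=> //; rewrite /ramp max_l// subr_le0 -(ler_pM2l a0) E; lra.
right; split; first exact: ltW.
rewrite /ramp max_r; first by rewrite opprB addrC subrK.
by rewrite subr_ge0 -(ler_pM2l a0) E; lra.
Qed.

Lemma ramp_ge0 a s : 0 <= ramp a s.
Proof. by rewrite le_max lexx. Qed.

Lemma ramp_le1 a s : 0 < a -> s <= 1 -> ramp a s <= 1.
Proof.
move=> a0 s1; rewrite ge_max ler01/= gerBl mulr_ge0// ?invr_ge0; lra.
Qed.

Lemma normr_ramp_le a s : 0 < a < 1 -> `|ramp a s| <= a^-1 * `|s|.
Proof.
move=> /andP[a0 a1]; rewrite ger0_norm ?ramp_ge0//.
rewrite ge_max mulr_ge0 ?invr_ge0 ?(ltW a0)//=.
rewrite -(ler_pM2l a0) mulrBr !mulVKf ?gt_eqF//.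
by have := ler_norm s; lra.
Qed.

(** The sum is the convex combination [(1 - w) * g + w * u]. *)
Lemma convex_norm_le1 w g u : 0 <= w <= 1 -> `|g| <= 1 -> `|u| <= 1 ->
  `|g + (w * u - w * g)| <= 1.
Proof.
rewrite !ler_norml => /andP[w0 w1] /andP[g0 g1] /andP[u0 u1].
by apply/andP; split; nra.
Qed.

(** Where the ramp is nonzero, [f * g >= 1 - a] forces [|f| >= 1 - a] with the sign of [g], so
    [clip a f] is that sign. Moving [g] away from its sign by at most [1 - |g|] stays in
    [[-1, 1]]. *)
Lemma ramp_clip_norm_le1 a f g : 0 < a < 1 -> `|f| <= 1 -> `|g| <= 1 ->
  `|g + (ramp a (f * g) * g - ramp a (f * g) * clip a f)| <= 1.
Proof.
move=> a01 f1 g1; have /andP[a0 a1] := a01.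
have fg1 : f * g <= 1.
  by rewrite (le_trans (ler_norm _))// normrM mulr_ile1.
have w0 := ramp_ge0 a (f * g); have w1 := ramp_le1 _ _ a0 fg1.
have [[_ ->]|[+ _]] := ramp_cases _ (f * g) a0; first by rewrite !mul0r subr0 addr0.
move: (ramp a _) w0 w1 => w w0 w1 fga.
move: f1 g1; rewrite !ler_norml => /andP[f0 f1] /andP[g0 g1].
case: (clip_cases _ f a01) => -[] + E; rewrite ?ler_norml => fa.
- rewrite E; have g0' : 0 <= g by nra.
  by apply/andP; split; nra.
- rewrite E; have g0' : g <= 0 by nra.
  by apply/andP; split; nra.
(* Here [f * g >= 1 - a] leaves only the boundary [|f| = 1 - a], where the truncation is still 1 or
   -1. *)
- have /andP[fa1 fa2] := fa.
  have [g0'|g0'] := leP 0 g.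
    have f_gt0 : 0 < f by nra.
    have fE : f = 1 - a by apply/le_anti/andP; split; nra.
    have -> : clip a f = 1.
      by apply: (@mulfI _ (1 - a)); [rewrite gt_eqF//; lra|rewrite E mulr1].
    by apply/andP; split; nra.
  have f_lt0 : f < 0 by nra.
  have fE : f = - (1 - a) by apply/le_anti/andP; split; nra.
  have -> : clip a f = -1.
    by apply: (@mulfI _ (1 - a)); [rewrite gt_eqF//; lra|rewrite E mulrN1].
  by apply/andP; split; nra.
Qed.

(* Without the factor 1/2 this fails at f = 1 and g = 1 - a. *)
Lemma ramp_defect_norm_le1 a f g : 0 < a < 1 -> `|f| <= 1 -> `|g| <= 1 ->
  `|g + 2^-1 * (a * (g - ramp a (f * g) * g) - (g - f))| <= 1.
Proof.
move=> /andP[a0 a1] f1 g1.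
have fg1 : f * g <= 1.
  by rewrite (le_trans (ler_norm _))// normrM mulr_ile1.
have w1 := ramp_le1 _ _ a0 fg1.
(* [r] is the minimum of [a] and [1 - f * g]; only its upper bound [1 - f * g] is kept. *)
have [r r0 [rfg ->]] : exists2 r : R, 0 <= r & r <= 1 - f * g /\
    g + 2^-1 * (a * (g - ramp a (f * g) * g) - (g - f)) =
    2^-1 * (g + f + r * g).
  exists (a * (1 - ramp a (f * g))); first by rewrite mulr_ge0//; lra.
  split; last by field.
  by have [[sa ->]|[_ ->]] := ramp_cases _ (f * g) a0; lra.
move: f1 g1; rewrite !ler_norml => /andP[f0 f1] /andP[g0 g1].
(* For [g >= 0], [g + f + r * g <= 2 * g + f * (1 - g ^+ 2) <= 2 - (1 - g) ^+ 2]; the other sign is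
   symmetric. *)
have [g0'|g0'] := leP 0 g.
  have rg0 : 0 <= r * g by rewrite mulr_ge0.
  have rg : r * g <= (1 - f * g) * g by rewrite ler_wpM2r.
  have fg : f * (1 - g ^+ 2) <= 1 - g ^+ 2 by rewrite ler_piMl//; nra.
  have g2 := sqr_ge0 (1 - g).
  by apply/andP; split; lra.
have rg0 : r * g <= 0 by rewrite mulr_ge0_le0// ltW.
have rg : (1 - f * g) * g <= r * g by rewrite ler_wnM2r// ltW.
have fg : - (1 - g ^+ 2) <= f * (1 - g ^+ 2) by rewrite -mulN1r ler_wpM2r//; nra.
have g2 := sqr_ge0 (1 + g).
by apply/andP; split; lra.
Qed.

End clip_ramp.

(** * Products and compositions in [C0 R L] *)

Section C0_ops.
Context {R : realType} {L : topologicalType}.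
Implicit Types f g : C0 R L.

(** The set [e <= |F|] is closed inside the compact set [e / (|M| + 1) <= |g|]; this divisor is
    positive for every real [M]. *)
Lemma C0_pred_le (F : L -> R) (M : R) g : continuous F ->
  (forall x, `|F x| <= M * `|g x|) -> F \in @C0_pred R L.
Proof.
move=> cF Fg; rewrite inE; split=> // e e0.
have M0 : 0 < `|M| + 1 by rewrite ltr_wpDl.
apply: (subclosed_compact (closed_norm_ge cF)
  (@C0_vanishes_at_infinity _ _ g _ (divr_gt0 e0 M0))) => x /= eF.
rewrite ler_pdivrMr// (le_trans eF)// (le_trans (Fg x))// mulrC ler_wpM2l//.
by rewrite (le_trans (ler_norm M))// lerDl.
Qed.

Lemma C0_mul_subproof f g : (fun x => f x * g x) \in @C0_pred R L.
Proof.
apply: (@C0_pred_le _ `|f| g) => x; last by rewrite normrM ler_wpM2r// ler_C0_norm.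
by apply: cvgM; exact: C0_continuous.
Qed.

Definition C0_mul f g : C0 R L := MkC0 (C0_mul_subproof f g).

Lemma C0_comp_subproof (F : R -> R) (M : R) (cF : continuous F)
    (FM : forall s, `|F s| <= M * `|s|) f : (fun x => F (f x)) \in @C0_pred R L.
Proof.
apply: (@C0_pred_le _ M f) => x; last exact: FM.
by apply: (@continuous_comp _ _ _ f F); [exact: C0_continuous|exact: cF].
Qed.

Lemma C0_mulDr (w : C0 R L) (k : R) f g :
  C0_mul w (k *: f + g) = k *: C0_mul w f + C0_mul w g.
Proof.
apply/val_inj/funext => x /=.
by rewrite !fctE mulrDr; congr (_ + _); exact: mulrCA.
Qed.

Lemma C0_norm_le f (M : R) : 0 <= M -> (forall x, `|f x| <= M) -> `|f| <= M.
Proof. exact: sup_norm_le. Qed.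

Lemma C0_norm_mul f g : `|C0_mul f g| <= `|f| * `|g|.
Proof.
apply: C0_norm_le => [|x]; first by rewrite mulr_ge0.
by rewrite normrM ler_pM// ler_C0_norm.
Qed.

End C0_ops.

Lemma norm_dual_le {R : realType} {V : normedModType R} (mu : dual V) x :
  `|mu x| <= `|mu| * `|x|.
Proof. exact: le_op_norm. Qed.

(** * Functionals attaining their norm at [g], and their localization by a weight *)

Section face.
Context {R : realType} {L : topologicalType}.
Variables (mu : dual (C0 R L)) (g : C0 R L).
Hypotheses (mu1 : `|mu| = 1) (mug : mu g = 1).

(** [mu (g + v) <= 1 = mu g]. *)
Lemma supporting_le0 (v : C0 R L) : (forall x, `|g x + v x| <= 1) -> mu v <= 0.
Proof.
move=> gv; rewrite -(lerD2l (mu g)) addr0 {2}mug -linearD.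
rewrite (le_trans (ler_norm _))// (le_trans (norm_dual_le _ _))// mu1 mul1r.
exact: C0_norm_le.
Qed.

Section localized.
Variable w : C0 R L.
Hypotheses (g1 : forall x, `|g x| <= 1) (w01 : forall x, 0 <= w x <= 1).

Lemma mul_le_supporting (u : C0 R L) : (forall x, `|u x| <= 1) ->
  mu (C0_mul w u) <= mu (C0_mul w g).
Proof.
move=> u1; rewrite -subr_le0 -linearB; apply: supporting_le0 => x.
exact: convex_norm_le1.
Qed.

(** The same convexity with weight [1 - w], written as a difference because [1 - w] need not vanish
    at infinity. *)
Lemma rest_le_supporting (u : C0 R L) : (forall x, `|u x| <= 1) ->
  mu (u - C0_mul w u) <= 1 - mu (C0_mul w g).
Proof.
move=> u1; rewrite -{1}mug -linearB -subr_le0 -linearB.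
apply: supporting_le0 => x.
rewrite (_ : _ + _ = g x + ((1 - w x) * u x - (1 - w x) * g x)).
  by apply: convex_norm_le1 => //; have := w01 x; lra.
change (g x + ((u x - w x * u x) - (g x - w x * g x)) =
  g x + ((1 - w x) * u x - (1 - w x) * g x)).
by ring.
Qed.

(** Defined before [c0] is assumed: if the normalizing constant is 0, so is its inverse, and the
    functional is zero. *)
Let nuf (u : C0 R L) : R^o := (mu (C0_mul w g))^-1 * mu (C0_mul w u).

Lemma localize_subproof : nuf \in @bounded_op_pred R (C0 R L) R^o.
Proof.
rewrite inE; split=> [k u v|r].
  rewrite /nuf C0_mulDr linearP mulrDr; congr (_ + _); exact: mulrCA.
exists (`|(mu (C0_mul w g))^-1| * (`|w| * r)) => u ur.
rewrite normrM ler_wpM2l// (le_trans (norm_dual_le _ _))// mu1 mul1r.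
by rewrite (le_trans (C0_norm_mul _ _))// ler_wpM2l.
Qed.

Definition localize : dual (C0 R L) := MkBoundedOp localize_subproof.

Hypothesis c0 : 0 < mu (C0_mul w g).

Lemma localizeE (u : C0 R L) :
  localize u = (mu (C0_mul w g))^-1 * mu (C0_mul w u).
Proof. by []. Qed.

Lemma localize_supporting : localize g = 1.
Proof. by rewrite localizeE mulVf ?gt_eqF. Qed.

Lemma localize_le1 (u : C0 R L) : (forall x, `|u x| <= 1) -> localize u <= 1.
Proof.
by move=> u1; rewrite localizeE mulrC ler_pdivrMr// mul1r mul_le_supporting.
Qed.

Lemma norm_localize : `|localize| = 1.
Proof.
apply/eqP; rewrite eq_le; apply/andP; split.
  apply: op_norm_le => u u1; rewrite ler_norml.
  have ux x : `|u x| <= 1 by rewrite (le_trans (ler_C0_norm _ _)).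
  rewrite localize_le1// andbT lerNl -linearN localize_le1// => x.
  by rewrite [(- u) x](_ : _ = - u x)// normrN.
have := norm_dual_le localize g; rewrite localize_supporting normr1.
move=> /le_trans; apply; rewrite ler_piMr//.
exact: C0_norm_le.
Qed.

(** With [c = mu (C0_mul w g)] and [nu] for [localize], [mu u - nu u = mu (u - w u) - (1 - c) * nu
    u], and both terms are at most [1 - c]. *)
Lemma norm_localizeB : `|localize - mu| <= 2 * (1 - mu (C0_mul w g)).
Proof.
have H (u : C0 R L) : (forall x, `|u x| <= 1) ->
    mu u - localize u <= 2 * (1 - mu (C0_mul w g)).
  move=> u1.
  have uN x : `|(- u) x| <= 1 by rewrite [(- u) x](_ : _ = - u x)// normrN.
  have lN : - localize u <= 1 by rewrite -linearN; exact: localize_le1.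
  have muB : mu u - mu (C0_mul w g) * localize u <= 1 - mu (C0_mul w g).
    rewrite localizeE mulVKf ?gt_eqF// -linearB.
    exact: rest_le_supporting.
  have c1 : mu (C0_mul w g) <= 1.
    rewrite -[leRHS]mug -subr_ge0 -linearB -oppr_le0 -linearN.
    apply: supporting_le0 => x.
    rewrite (_ : _ + _ = w x * g x); last first.
      by change (g x - (g x - w x * g x) = w x * g x); ring.
    have /andP[w0 w1] := w01 x.
    by rewrite normrM mulr_ile1// ger0_norm.
  by nra.
apply: op_norm_le => u u1.
have ux x : `|u x| <= 1 by rewrite (le_trans (ler_C0_norm _ _)).
rewrite [(localize - mu) u](_ : _ = localize u - mu u)// ler_norml.
apply/andP; split; first by have := H _ ux; lra.
have uN x : `|(- u) x| <= 1 by rewrite [(- u) x](_ : _ = - u x)// normrN.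
have -> : localize u - mu u = mu (- u) - localize (- u).
  by rewrite !linearN opprK addrC.
exact: H.
Qed.

End localized.
End face.

(** * The perturbed pair and property (nu) *)

Lemma numerical_bpb {R : realType} {L : topologicalType} (e : R)
    (f0 : C0 R L) (mu : dual (C0 R L)) (T : bounded_op (C0 R L) (C0 R L)) :
  0 < e < 1 -> `|f0| = 1 -> `|mu| = 1 -> `|T| = 1 ->
  1 - e ^+ 2 / 50 < mu f0 -> `|mu (T f0)| = 1 ->
  exists (f1 : C0 R L) (nu : dual (C0 R L)),
    [/\ [/\ `|f1| = 1 & `|nu| = 1],
        `|nu (T f1)| = 1, nu f1 = 1,
        `|f1 - f0| < e & `|nu - mu| < e].
Proof.
move=> /andP[e0 e1] nf0 nmu nT muf0 muTf0.
have f0x x : `|f0 x| <= 1 by rewrite -nf0 ler_C0_norm.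
pose a := e / 2; have a0 : 0 < a by rewrite divr_gt0.
have a1 : a < 1 by rewrite /a; lra.
have a01 : 0 < a < 1 by rewrite a0.
pose f1 : C0 R L := MkC0 (C0_comp_subproof _ _ (continuous_clip a)
  (fun s => normr_clip_le _ s a01) f0).
have f1x x : `|f1 x| <= 1 by exact: normr_clip_le1.
have nT_le f : `|T f| <= `|f|.
  by rewrite (le_trans (le_op_norm _ _))// -[op_norm T]/(`|T|) nT mul1r.
have muT_le f : `|mu (T f)| <= `|f|.
  by rewrite (le_trans (norm_dual_le _ _))// nmu mul1r.
have nf1_le : `|f1| <= 1 by exact: C0_norm_le.
have f1f0 : `|f1 - f0| <= a.
  by apply: C0_norm_le => [|x]; [exact: ltW|exact: (clip_dist_le _ _ a01 (f0x x))].
have rest : `|f0 - (1 - a) *: f1| <= a.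
  by apply: C0_norm_le => [|x]; [exact: ltW|exact: (clip_rest_le _ _ a01 (f0x x))].
have muTf1 : `|mu (T f1)| = 1.
  apply/eqP; rewrite eq_le (le_trans (muT_le _))//=.
  have b0 : 0 < 1 - a by lra.
  (* Reduces to [1 - a <= (1 - a) * |mu (T f1)|], which follows from [1 = |mu (T f0)| <= (1 - a) *
     |mu (T f1)| + a]. *)
  rewrite -(ler_pM2l b0) -[X in X * `|_|](gtr0_norm b0) -normrM mulr1.
  have := le_trans (muT_le _) rest.
  have -> : mu (T (f0 - (1 - a) *: f1)) = mu (T f0) - (1 - a) * mu (T f1).
    by rewrite !linearB !linearZ.
  by move=> /(le_trans (lerB_dist _ _)); rewrite muTf0; lra.
pose g := mu (T f1) *: T f1.
have mug : mu g = 1.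
  rewrite /g linearZ; change (mu (T f1) * mu (T f1) = 1).
  by rewrite -expr2 -real_normK ?num_real// muTf1 expr1n.
have gx x : `|g x| <= 1.
  rewrite (le_trans (ler_C0_norm _ _))// normrZ muTf1 mul1r.
  exact: le_trans (nT_le _) _.
pose w : C0 R L := MkC0 (C0_comp_subproof _ _ (continuous_ramp a)
  (fun s => normr_ramp_le _ s a01) (C0_mul f0 g)).
have fg1 x : f0 x * g x <= 1.
  by rewrite (le_trans (ler_norm _))// normrM mulr_ile1.
have w01 x : 0 <= w x <= 1.
  by apply/andP; split; [exact: ramp_ge0|exact: (ramp_le1 _ _ a0 (fg1 x))].
(* A Markov inequality: [mu f0] close to 1 bounds the mass that the weight discards. *)
have defect : a * (1 - mu (C0_mul w g)) <= 1 - mu f0.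
  have : mu (2^-1 *: (a *: (g - C0_mul w g) - (g - f0))) <= 0.
    apply: (supporting_le0 _ _ nmu mug) => x.
    exact: (ramp_defect_norm_le1 _ _ _ a01 (f0x x) (gx x)).
  have -> : mu (2^-1 *: (a *: (g - C0_mul w g) - (g - f0))) =
      2^-1 * (a * (mu g - mu (C0_mul w g)) - (mu g - mu f0)).
    by rewrite linearZ linearB linearZ !linearB.
  by rewrite mug; lra.
(* Since [a = e / 2], the left side is below [(2 / a) * (e ^+ 2 / 50) = 2 * e / 25]. *)
have cE : 2 * (1 - mu (C0_mul w g)) < e.
  rewrite -(ltr_pM2l a0) mulrCA (le_lt_trans (ler_wpM2l _ defect))//.
  by rewrite /a; nra.
have c0 : 0 < mu (C0_mul w g) by lra.
pose nu := localize mu g nmu w.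
have nug : nu g = 1 by exact: localize_supporting.
have nnu : `|nu| = 1 by exact: norm_localize.
(* The lower bound is [nu (g - f1) <= 0], obtained by testing [mu] on [g + w (g - f1)]. *)
have nuf1 : nu f1 = 1.
  apply/eqP; rewrite eq_le localize_le1//=.
  rewrite -nug -subr_le0 -linearB.
  change ((mu (C0_mul w g))^-1 * mu (C0_mul w (g - f1)) <= 0).
  rewrite mulr_ge0_le0 ?invr_ge0 ?(ltW c0)//.
  apply: (supporting_le0 _ _ nmu mug) => x.
  change (`|g x + w x * (g x - f1 x)| <= 1).
  by rewrite mulrBr; exact: (ramp_clip_norm_le1 _ _ _ a01 (f0x x) (gx x)).
exists f1, nu; split=> //.
- split=> //; apply/eqP; rewrite eq_le nf1_le/=.
  have := norm_dual_le nu f1; rewrite nuf1 normr1 nnu mul1r; exact.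
- have : `|nu g| = 1 by rewrite nug normr1.
  by rewrite /g linearZ normrM muTf1 mul1r.
- by rewrite (le_lt_trans f1f0)// /a; lra.
- exact: le_lt_trans (norm_localizeB _ _ _ _ _ _ _ _) cE.
Qed.

Theorem theorem4p6 (R : realType) (L : topologicalType)
    (L_lc : locally_compact [set: L]) (L_hausdorff : hausdorff_space L) :
  (forall e : R, 0 < e < 1 / 4 ->
    forall (f0 : C0 R L) (mu : dual (C0 R L)) (T : bounded_op (C0 R L) (C0 R L)),
      `|f0| = 1 -> `|mu| = 1 -> `|T| = 1 ->
      1 - e ^+ 2 / 50 < mu f0 -> `|mu (T f0)| = 1 ->
      exists (f1 : C0 R L) (nu : dual (C0 R L)),
        [/\ [/\ `|f1| = 1 & `|nu| = 1],
            `|nu (T f1)| = 1, nu f1 = 1,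
            `|f1 - f0| < e & `|nu - mu| < e])
  /\ property_nu (C0 R L).
Proof.
split=> [e /andP[e0 e4] f0 mu T|e e0].
  by apply: numerical_bpb; rewrite e0/=; lra.
(* Property (nu) allows large [e]; the cap brings it into the range [d < 1]. *)
pose d := Num.min e 2^-1.
have d0 : 0 < d by rewrite lt_min e0 invr_gt0 ltr0n.
have d1 : 0 < d < 1 by rewrite d0 gt_min; apply/orP; right; lra.
have de : d <= e by rewrite ge_min lexx.
exists (d ^+ 2 / 50); first by rewrite divr_gt0// exprn_gt0.
move=> T f0 mu nT nf0 nmu muf0 muTf0.
have [f1 [nu [[nf1 nnu] nuTf1 nuf1 f10 numu]]] :=
  numerical_bpb _ _ _ _ d1 nf0 nmu nT muf0 muTf0.
(* The operator is left unchanged, so its distance term is 0. *)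
exists nu, f1, T; split=> //.
by rewrite subrr normr0 !gt_max e0 (lt_le_trans f10) ?(lt_le_trans numu).
Qed.
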